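(* Let $p_1<p_2$ be primes and $n_1,n_2$ positive integers. Let $G$ be a finite non-cyclic abelian group of order $p_1^{n_1}p_2^{n_2}$ and let $P_i$ be the Sylow $p_i$-subgroup of $G$, $i=1,2$. Then the following hold. (i) Suppose that exactly one of $P_1$, $P_2$ is non-cyclic. If $P_i$ is non-cyclic, then $P_j$ is a minimum cut-set of $\mathcal{P}(G)$ and so $\kappa(\mathcal{P}(G))=|P_j|=p_j^{n_j}$, where $\{i,j\}=\{1,2\}$. In fact, if $p_1\geq 3$, or if $p_1=2$ and $P_2$ is non-cyclic, then there is only one minimum cut-set of $\mathcal{P}(G)$. (ii) Suppose that both $P_1$ and $P_2$ are non-cyclic. If $p_1\geq 3$ and $G$ has a maximal cyclic subgroup $C$ of order $p_1p_2$, then $\kappa(\mathcal{P}(G))=\min\{|P_1|,|P_2|,|\widetilde{C}|\}$. (iii) Suppose that both $P_1$ and $P_2$ are non-cyclic and that $P_1$ is elementary abelian. Then $\kappa(\mathcal{P}(G))=\min\{|P_1|,|P_2|,|\widetilde{C}|\}$, where $C$ is a maximal cyclic subgroup of $G$ of minimum possible order.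
   Context: The power graph $\mathcal{P}(G)$ of a group $G$ is the simple graph with vertex set $G$ in which two distinct vertices $x,y$ are adjacent iff $x\in\langle y\rangle$ or $y\in\langle x\rangle$. A cut-set of a simple graph $\Gamma$ with vertex set $V$ is a subset $X\subseteq V$ such that the induced subgraph on $V\setminus X$ is disconnected (i.e. $V\setminus X$ is the disjoint union of two non-empty sets with no edge between them). A minimum cut-set is a cut-set $X$ with $|X|\leq|Y|$ for every cut-set $Y$. The vertex connectivity $\kappa(\Gamma)$ is the minimum number of vertices whose removal leaves a graph that is disconnected or has only one vertex. A maximal cyclic subgroup of $G$ is a cyclic subgroup not properly contained in any cyclic subgroup of $G$; ''of minimum possible order'' means of smallest order among all maximal cyclic subgroups of $G$. For a cyclic group $H$, $\widetilde{H}$ denotes the set of all non-generators of $H$. *)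

(* Defs.v *)
From mathcomp Require Import all_boot all_fingroup all_solvable.

Set Implicit Arguments.
Unset Strict Implicit.
Unset Printing Implicit Defensive.

Import GroupScope.

(* A finite simple graph is given by its vertex set V : {set T} and an
   adjacency relation e : rel T, of which only the restriction to V matters. *)
Section Connectivity.

Variables (T : finType) (V : {set T}) (e : rel T).

Definition disconnected (U : {set T}) : bool :=
  [exists A : {set T}, exists B : {set T},
    [&& A != set0, B != set0, [disjoint A & B], A :|: B == U
      & [forall a in A, forall b in B, ~~ e a b]]].

Definition cutset (X : {set T}) : bool :=
  (X \subset V) && disconnected (V :\: X).

Definition min_cutset (X : {set T}) : bool :=
  cutset X && [forall Y : {set T}, cutset Y ==> (#|X| <= #|Y|)].

(* The default value #|V| is never the minimum when V is non-empty: removing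
   all vertices but one is always allowed. *)
Definition vertex_connectivity : nat :=
  \big[minn/#|V|]_(X : {set T} | (X \subset V) &&
      (disconnected (V :\: X) || (#|V :\: X| == 1%N))) #|X|.

End Connectivity.

Section PowerGraph.

Variable gT : finGroupType.

(* The cyclic subgroups <[x]>, <[y]> are the same in G and in gT, so the power
   graph of a subgroup G of gT is (G, power_adj). *)
Definition power_adj : rel gT :=
  [rel x y | (x != y) && ((x \in <[y]>) || (y \in <[x]>))].

Lemma power_adj_irr : irreflexive power_adj.
Proof. by move=> x; rewrite /power_adj /= eqxx. Qed.

Lemma power_adj_sym : symmetric power_adj.
Proof. by move=> x y; rewrite /power_adj /= eq_sym orbC. Qed.

Definition max_cyclic (G C : {group gT}) : bool :=
  [max C of H | (H \subset G) && cyclic H].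

Definition min_order_max_cyclic (G C : {group gT}) : bool :=
  max_cyclic G C && [forall D : {group gT}, max_cyclic G D ==> (#|C| <= #|D|)].

Definition nongenerators (H : {set gT}) : {set gT} :=
  [set x in H | ~~ generator H x].

End PowerGraph.

Arguments power_adj {gT}.

(* Main.v *)
Require Import Defs.
From mathcomp Require Import all_boot all_fingroup all_solvable.
From mathcomp Require Import zify.

Import GroupScope.

(** Write G = P * Q for the Sylow decomposition, with p and q the two primes,
    and identify a pair (u, v) in P x Q with the element u * v.  Since the
    orders are coprime, <[u * v]> is the product of <[u]> and <[v]>, so each
    inclusion between cyclic subgroups can be tested on the two coordinates.

    Upper bounds.  If P is not cyclic, it has two subgroups of order p.  Outside
    Q every element has a unique subgroup of order p inside its cyclic group,
    and adjacent elements share it; hence Q is a cut-set ([noncyclic_cutset]).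
    The generators of a maximal cyclic subgroup C are adjacent only to elements
    of C, hence the non-generators of C form a cut-set ([max_cyclic_cutset]).

    Lower bounds.  Let a cut-set X separate the remaining vertices into A and B.
    If a is in A and b in B, then <[a]> and <[b]> meet inside X, for a common
    element outside X would be joined to both.  Call a cyclic group covered when
    all its generators are in X.  An uncovered one has a generator in A or in B,
    which colours it, and two cyclic groups of different colours meet inside X.
    Everything follows by colouring the groups <[u * v]> of a grid of pairs.

    - If Q = <[r]> is cyclic, the grid is the single column of the <[u * r]>
      with u != 1.  If none is covered, both colours occur and Q is contained in
      X ([uncovered_cyclic_factor]).  A covered one costs
      totient #[u] * totient #|Q| vertices besides 1, more than #|Q| in all as
      soon as p > 2.  For p = 2, an X with fewer than #|Q| vertices can cover
      only one of them, with u an involution, and then one of the two sides lies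
      in u *: Q; an element of maximal order of that side gives an injection of
      Q into X ([cyclic_factor_le_cutset]).

    - If P and Q are not cyclic and X contains neither, pick u in P and v in Q
      outside X: the row of u and the column of v are coloured alike, say A
      ([exists_owned_row_column]).  Some cell (u', v') has the other colour, and
      comparing it with that row and that column puts <[u']> and <[v']> in X.
      When there is a maximal cyclic subgroup of order p * q these p + q - 1
      elements are enough ([cutset_lower_small]).

    - If P is elementary abelian, use only the v that generate maximal cyclic
      subgroups of Q.  Either X contains all non-generators of <[u' * v']>, or
      it contains two maximal cyclic subgroups of Q ([uncovered_lower]).  A
      covered cell is affordable only for p = 2, and then it is unique; as every
      vertex outside X also lies in another cell, the colouring argument
      survives and puts all of P but one element in X, the lost element being
      made up for by a generator of the covered cell ([covered_lower]). *)

Set Implicit Arguments.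
Unset Strict Implicit.
Unset Printing Implicit Defensive.

(** * Numerical inequalities *)

Section Arithmetic.

Lemma leq_predn_mul p q : 2 < p -> p < q -> p + q <= (p.-1 * q.-1).+1.
Proof. by case: p => // p; case: q => // q /=; nia. Qed.

Lemma nongenerators_arith p q b : 0 < p -> 0 < q ->
  (p * (q * b) - p.-1 * (q.-1 * b) = (p + q).-1 * b)%N.
Proof. by case: p => // p; case: q => // q /= _ _; nia. Qed.

(** The bound (p + q).-1 * c is the number of non-generators of a
    cyclic group of order p * (q * c) when c is a power of q; two cyclic
    subgroups of order at least q * c already have that many generators. *)
Lemma two_gens_arith p q a b c n : p < q ->
  q.-1 * c <= a -> q.-1 * c <= b -> a + b <= n -> (p + q).-1 * c <= n.
Proof.
move=> lt_pq le_a le_b; apply: leq_trans; apply: leq_trans (leq_add le_a le_b).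
by rewrite -mulnDl leq_mul2r; apply/orP; right; move: lt_pq; lia.
Qed.

End Arithmetic.

(** * Cut-sets and vertex connectivity *)

Section CutSets.

Variables (T : finType) (V : {set T}) (e : rel T).

Lemma disconnected_card (U : {set T}) : disconnected e U -> 1 < #|U|.
Proof.
case/existsP=> A /existsP[B] /and5P[A0 B0 dAB /eqP<- _].
rewrite cardsU disjoint_setI0 // cards0 subn0.
by move: A0 B0; rewrite -!card_gt0; lia.
Qed.

Lemma vertex_connectivity_le (X : {set T}) :
  cutset V e X -> vertex_connectivity V e <= #|X|.
Proof.
case/andP=> sXV dX; rewrite /vertex_connectivity.
have: X \in index_enum {set T} by rewrite mem_index_enum.
elim: (index_enum _) => // Y s IHs; rewrite inE big_cons.
case/predU1P=> [<-|/IHs le_s]; first by rewrite sXV dX geq_minl.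
by case: ifP => // _; rewrite geq_min le_s orbT.
Qed.

(** The sets leaving a single vertex also compete in the minimum, but they have
    #|V| - 1 elements, while a cut-set has at most #|V| - 2. *)
Lemma vertex_connectivity_eq (X : {set T}) :
  cutset V e X -> (forall Y, cutset V e Y -> #|X| <= #|Y|) ->
  vertex_connectivity V e = #|X|.
Proof.
move=> cutX minX; apply/eqP; rewrite eqn_leq vertex_connectivity_le //=.
case/andP: (cutX) => sXV dX.
apply: (big_rec (leq #|X|)) => [|Y k]; first exact: subset_leq_card.
rewrite leq_min => /andP[sYV dY] ->; rewrite andbT.
case/orP: dY => [dY|/eqP oY]; first by apply: minX; rewrite /cutset sYV.
have := disconnected_card dX; have := cardsD V X; have := cardsD V Y.
rewrite !(setIidPr _) // oY; have := subset_leq_card sYV; lia.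
Qed.

Lemma cutset_intro (X A B : {set T}) :
    X \subset V -> A != set0 -> B != set0 -> [disjoint A & B] ->
    A :|: B = V :\: X -> (forall a b, a \in A -> b \in B -> ~~ e a b) ->
  cutset V e X.
Proof.
move=> sXV A0 B0 dAB defU noE; rewrite /cutset sXV.
apply/existsP; exists A; apply/existsP; exists B.
rewrite A0 B0 dAB defU eqxx.
by apply/forall_inP => a Aa; apply/forall_inP => b Bb; apply: noE.
Qed.

End CutSets.

(** * Colouring cyclic subgroups by the sides of a cut-set *)

Section Separations.

Variable gT : finGroupType.
Implicit Types (G : {group gT}) (X A B : {set gT}) (a b g h z : gT).

(** The absence of edges between A and B is recorded in the form used below:
    a vertex of the intersection of <[a]> and <[b]> lying outside X would be on
    both sides.  Disjointness of A and B is the case a = b. *)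
Definition separates G X A B : Prop :=
  [/\ A != set0, B != set0, A :|: B = G :\: X
    & forall a b, a \in A -> b \in B -> <[a]> :&: <[b]> \subset X].

Lemma cutset_separates G X :
  cutset G power_adj X -> exists A B, separates G X A B.
Proof.
case/andP=> _ /existsP[A /existsP[B /and5P[A0 B0 dAB /eqP defU /forall_inP noE]]].
exists A, B; split=> // a b Aa Bb; apply/subsetP=> z /setIP[az bz].
have /forall_inP/(_ b Bb) := noE a Aa; rewrite /power_adj /= => noab.
have nAB c : c \in A -> c \in B -> False.
  by move=> Ac Bc; have /pred0P/(_ c) := dAB; rewrite /= Ac Bc.
apply: contraLR isT => Xz.
have: z \in A :|: B.
  rewrite defU inE Xz; have: a \in G :\: X by rewrite -defU inE Aa.
  by case/setDP=> Ga _; apply: subsetP az; rewrite cycle_subG.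
case/setUP=> [Az | Bz].
  have /forall_inP/(_ b Bb) := noE z Az; rewrite /power_adj /= bz andbT negbK.
  by move/eqP=> def_z; case: (nAB b); rewrite // -def_z.
have /forall_inP/(_ z Bz) := noE a Aa.
rewrite /power_adj /= az orbT andbT negbK.
by move/eqP=> def_z; case: (nAB z); rewrite // -def_z.
Qed.

Lemma separatesC G X A B : separates G X A B -> separates G X B A.
Proof. by case=> A0 B0 dU sX; split=> // [|a b Ba Ab]; rewrite 1?setUC 1?setIC ?sX. Qed.

Definition covered X g := [set x | generator <[g]> x] \subset X.

(** This is the colouring of cyclic groups: for a cut-set X with sides A and B,
    an uncovered group is owned by exactly one of A and B. *)
Definition owns A g : Prop := exists2 a, a \in A & <[a]> = <[g]>.

Lemma not_coveredP X g :
  ~~ covered X g -> exists2 h, <[h]> = <[g]> & h \notin X.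
Proof. by case/subsetPn=> h; rewrite inE => /eqP->; exists h. Qed.

Lemma covered_card X g : covered X g -> totient #[g] <= #|X|.
Proof. by rewrite totient_gen; apply: subset_leq_card. Qed.

Lemma covered_card1 X g : g != 1 -> 1 \in X -> covered X g -> totient #[g] < #|X|.
Proof.
move=> g1 X1 Xg; rewrite totient_gen (cardsD1 1 X) X1 ltnS.
apply: subset_leq_card; rewrite subsetD1; apply/andP; split=> //.
by rewrite inE /generator cycle1 cycle_eq1.
Qed.

(** Distinct cyclic groups have disjoint sets of generators. *)
Lemma covered2_card X g h :
    covered X g -> covered X h -> <[g]> != <[h]> ->
  totient #[g] + totient #[h] <= #|X|.
Proof.
move=> Xg Xh neq; rewrite !totient_gen -cardsUI.
rewrite [_ :&: _](_ : _ = set0) ?cards0 ?addn0.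
  by apply: subset_leq_card; rewrite subUset; apply/andP.
apply/setP=> x; rewrite !inE; apply/negP=> /andP[/eqP gx /eqP hx].
by rewrite gx hx eqxx in neq.
Qed.

Lemma cycle_covered X g : <[g]> \subset X -> covered X g.
Proof.
move=> sgX; apply: subset_trans sgX; apply/subsetP=> x; rewrite inE.
exact: cycle_generator.
Qed.

Section Separated.

Variables (G : {group gT}) (X A B : {set gT}).
Hypothesis sepAB : separates G X A B.

Lemma sep_mem z : z \in A -> z \in G /\ z \notin X.
Proof.
case: sepAB => _ _ dU _ Az.
by have: z \in A :|: B by [rewrite inE Az]; rewrite dU inE => /andP[].
Qed.

Lemma sep_cap a b z :
  a \in A -> b \in B -> z \in <[a]> -> z \in <[b]> -> z \in X.
Proof.
case: sepAB => _ _ _ sX Aa Bb az bz.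
by apply: (subsetP (sX a b Aa Bb)); rewrite inE az.
Qed.

Lemma owns_cap g h z :
  owns A g -> owns B h -> z \in <[g]> -> z \in <[h]> -> z \in X.
Proof. by case=> a Aa <- [b Bb <-]; apply: sep_cap. Qed.

Lemma owns_or g : g \in G -> ~~ covered X g -> owns A g \/ owns B g.
Proof.
case: sepAB => _ _ dU _ Gg /not_coveredP[h hg X'h].
have: h \in A :|: B.
  rewrite dU inE X'h; have := cycle_id h; rewrite hg.
  by apply: subsetP; rewrite cycle_subG.
by case/setUP=> ?; [left | right]; exists h.
Qed.

(** Any vertex of <[g]> outside X is on the same side as the generators of
    <[g]> outside X, being a power of them. *)
Lemma owns_mem a g :
  g \in G -> ~~ covered X g -> a \in A -> a \in <[g]> -> owns A g.
Proof.
move=> Gg cg Aa ga; case: (owns_or Gg cg) => // -[b Bb bg].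
have [_ /negP[]] := sep_mem Aa.
by apply: (sep_cap Aa Bb); rewrite ?cycle_id ?bg.
Qed.

Lemma owned_mem g z :
  owns A g -> g \in G -> z \in <[g]> -> z \notin X -> z \in A.
Proof.
move=> Ag Gg gz X'z; case: sepAB => _ _ dU _.
have: z \in A :|: B.
  by rewrite dU inE X'z; apply: subsetP gz; rewrite cycle_subG.
case/setUP=> // Bz; case: Ag => a Aa ag.
by case/negP: X'z; apply: (sep_cap Aa Bz); rewrite ?cycle_id ?ag.
Qed.

Lemma sep1 : 1 \in X.
Proof.
case: sepAB => /set0Pn[a Aa] /set0Pn[b Bb] _ _.
by apply: (sep_cap Aa Bb); rewrite group1.
Qed.

End Separated.

End Separations.

(** * Cyclic subgroups of p-groups *)

Section PGroups.

Variables (gT : finGroupType) (p : nat) (P : {group gT}).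
Hypotheses (p_pr : prime p) (pP : p.-group P).

Lemma pgroup_order_gt1 (u : gT) :
  u \in P -> u != 1 -> exists k, #[u] = (p ^ k.+1)%N.
Proof.
move=> Pu u1; have /p_natP[[|k] ok] := mem_p_elt pP Pu; last by exists k.
by move: u1; rewrite -order_eq1 ok expn0.
Qed.

Lemma totient_p_elt (u : gT) :
  u \in P -> u != 1 -> p.-1 <= totient #[u].
Proof.
move=> Pu u1; have [k ->] := pgroup_order_gt1 Pu u1.
by rewrite totient_pfactor //= leq_pmulr // expn_gt0 prime_gt0.
Qed.

Lemma mem_cycle_prime_power (v y : gT) :
  v \in P -> y \in <[v]> -> v \notin <[y]> -> y \in <[v ^+ p]>.
Proof.
move=> Pv /cycleP[i ->] vy.
have [/dvdnP[j ->]|pi] := boolP (p %| i).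
  by rewrite mulnC expgM mem_cycle.
case/negP: vy.
have [v1|v1] := eqVneq v 1; first by rewrite v1 group1.
have [k ok] := pgroup_order_gt1 Pv v1.
have: generator <[v]> (v ^+ i).
  by rewrite generator_coprime ok coprime_pexpl // prime_coprime.
by move/eqP<-; apply: cycle_id.
Qed.

(** If all elements killed by p were in <[v]>, then 'Ohm_1(P) would be cyclic,
    so P would have rank at most 1 and be cyclic. *)
Lemma noncyclic_new_elt (v : gT) :
    abelian P -> ~~ cyclic P -> v \in P ->
  exists2 t, t \in P & (t ^+ p == 1) && (t \notin <[v]>).
Proof.
move=> abP ncP Pv; have [sLv|] := boolP ('Ldiv_p(P) \subset <[v]>); last first.
  by case/subsetPn=> t; rewrite !inE => /andP[Pt tp1] vt; exists t; rewrite ?tp1.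
case/negP: ncP; rewrite abelian_rank1_cyclic // (rank_pgroup pP).
rewrite p_rank_abelian //.
have sO: 'Ohm_1(P) \subset <[v]> by rewrite (OhmE 1 pP) gen_subG.
have cO := cyclicS sO (cycle_cyclic v).
have aO: p.-abelem 'Ohm_1(P) by rewrite Ohm1_abelem.
have [/congr_group/= -> | O1] := eqVneq 'Ohm_1(P)%G 1%G.
  by rewrite cards1 logn1.
have /= -> := cyclic_abelem_prime aO cO O1.
by rewrite logn_prime // eqxx.
Qed.

End PGroups.

(** * Coordinates in an abelian product of coprime factors *)

Section CoprimeProduct.

Variables (gT : finGroupType) (G P Q : {group gT}).
Hypotheses (abelG : abelian G) (defG : P * Q = G) (coPQ : coprime #|P| #|Q|).
Implicit Types (u v x y z : gT) (X S : {set gT}).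

Lemma factorG z : z \in G -> exists x y, [/\ x \in P, y \in Q & z = x * y].
Proof. by rewrite -defG => /mulsgP[x y Px Qy ->]; exists x, y. Qed.

Lemma mem_cross x y : x \in P -> y \in Q -> x * y \in G.
Proof. by rewrite -defG; apply: mem_mulg. Qed.

Lemma left_factor_sub : P \subset G. Proof. by rewrite -defG mulG_subl. Qed.
Lemma right_factor_sub : Q \subset G. Proof. by rewrite -defG mulG_subr. Qed.

Lemma cross_coprime x y : x \in P -> y \in Q -> coprime #[x] #[y].
Proof.
move=> Px Qy; apply: coprime_dvdl (order_dvdG Px) _.
exact: coprime_dvdr (order_dvdG Qy) coPQ.
Qed.

Lemma cross_commute x y : x \in P -> y \in Q -> commute x y.
Proof.
move=> Px Qy; apply: (centsP abelG); first exact: (subsetP left_factor_sub).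
exact: (subsetP right_factor_sub).
Qed.

Lemma cross_order x y : x \in P -> y \in Q -> #[x * y] = (#[x] * #[y])%N.
Proof. by move=> Px Qy; rewrite orderM ?cross_coprime //; apply: cross_commute. Qed.

Lemma cross_totient x y :
  x \in P -> y \in Q -> totient #[x * y] = (totient #[x] * totient #[y])%N.
Proof. by move=> Px Qy; rewrite cross_order // totient_coprime ?cross_coprime. Qed.

Lemma cross_inj x y u v : x \in P -> y \in Q -> u \in P -> v \in Q ->
  x * y = u * v -> x = u /\ y = v.
Proof.
move=> Px Qy Pu Qv eq_xy.
have eq1: u^-1 * x = v * y^-1 by rewrite -(mulgK y x) eq_xy -mulgA mulKg.
have: u^-1 * x \in P :&: Q by rewrite inE {2}eq1 !groupM ?groupV.
rewrite coprime_TIg // => /set1P ux1.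
by move: eq1; rewrite ux1 => /esym/eqP; rewrite mulg_eq1 invgK => /eqP->;
   move/eqP: ux1; rewrite mulg_eq1 => /eqP/invg_inj->.
Qed.

Lemma cross_memE x y u v : x \in P -> y \in Q -> u \in P -> v \in Q ->
  (x * y \in <[u * v]>) = (x \in <[u]>) && (y \in <[v]>).
Proof.
move=> Px Qy Pu Qv; rewrite cycleM ?cross_coprime //; last exact: cross_commute.
apply/idP/andP=> [/mulsgP[x' y' ux' vy'] eq_xy | [ux vy]]; last exact: mem_mulg.
have Px': x' \in P by apply: subsetP ux'; rewrite cycle_subG.
have Qy': y' \in Q by apply: subsetP vy'; rewrite cycle_subG.
by have [-> ->] := cross_inj Px Qy Px' Qy' eq_xy.
Qed.

Lemma cross_mem_l x u v : x \in P -> u \in P -> v \in Q ->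
  (x \in <[u * v]>) = (x \in <[u]>).
Proof.
by move=> Px Pu Qv; rewrite -{1}[x]mulg1 cross_memE // group1 andbT.
Qed.

Lemma cross_mem_r y u v : y \in Q -> u \in P -> v \in Q ->
  (y \in <[u * v]>) = (y \in <[v]>).
Proof.
by move=> Qy Pu Qv; rewrite -{1}[y]mul1g cross_memE // group1.
Qed.

Lemma cross_cycle_inj x y u v : x \in P -> y \in Q -> u \in P -> v \in Q ->
  <[x * y]> = <[u * v]> -> <[x]> = <[u]> /\ <[y]> = <[v]>.
Proof.
move=> Px Qy Pu Qv eq_xy; have := cycle_id (x * y); have := cycle_id (u * v).
rewrite {1}eq_xy -{1}eq_xy !cross_memE // => /andP[xu yv] /andP[ux vy].
by split; apply/eqP; rewrite eqEsubset !cycle_subG ?xu ?ux ?yv ?vy.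
Qed.

(** Two cells of the same row u with different colours would force u into X, and
    likewise for columns; so a row through u outside X and a column through v
    outside X are each monochromatic, with the colour of the cell where they
    cross.  Any vertex of the other side then yields a cell (u', v') of the
    other colour.  The set S is left free: it is Q^# when any cell can be used,
    and the generators of maximal cyclic subgroups of Q in the finer count. *)
Lemma exists_owned_row_column X S :
    S \subset Q -> {in Q, forall y, exists2 v, v \in S & y \in <[v]>} ->
    {in P^# & S, forall u v, ~~ covered X (u * v)} ->
    cutset G power_adj X -> ~~ (P \subset X) -> ~~ (Q \subset X) ->
  exists A B, separates G X A B /\
    exists2 u, u \in P^# & exists2 v, v \in S &
    [/\ forall w, w \in S -> owns A (u * w),
        forall w, w \in P^# -> owns A (w * v)
      & exists2 u', u' \in P^# & exists2 v', v' \in S & owns B (u' * v')].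
Proof.
move=> max_cycle_gens_sub coverS uncov cutX /subsetPn[u Pu X'u] /subsetPn[y Qy X'y].
have [A0 [B0 sep0]] := cutset_separates cutX.
have u1: u \in P^#.
  by rewrite !inE Pu andbT; apply: contraNneq X'u => ->; apply: (sep1 sep0).
have [v Sv vy] := coverS y Qy; have Qv := subsetP max_cycle_gens_sub v Sv.
have inG w w' : w \in P^# -> w' \in S -> w * w' \in G.
  by move=> /setD1P[_ Pw] /(subsetP max_cycle_gens_sub); apply: mem_cross.
(* The names A and B are exchanged if necessary so that A owns the crossing. *)
have [A [B [sepAB Auv]]] : exists A B, separates G X A B /\ owns A (u * v).
  have [? | ?] := owns_or sep0 (inG _ _ u1 Sv) (uncov _ _ u1 Sv).
    by exists A0, B0.
  by exists B0, A0; split=> //; apply: separatesC.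
exists A, B; split=> //; exists u => //; exists v => //; split=> [w Sw | w Pw |].
- have [// | Bw] := owns_or sepAB (inG _ _ u1 Sw) (uncov _ _ u1 Sw).
  case/negP: X'u; apply: (owns_cap sepAB Auv Bw);
    by rewrite cross_mem_l ?cycle_id // (subsetP max_cycle_gens_sub).
- have [// | Bw] := owns_or sepAB (inG _ _ Pw Sv) (uncov _ _ Pw Sv).
  case/negP: X'y; have [_ Pw'] := setD1P Pw.
  by apply: (owns_cap sepAB Auv Bw); rewrite cross_mem_r.
have sepBA := separatesC sepAB.
case: sepBA => /set0Pn[b Bb] _ _ _; have sepBA := separatesC sepAB.
have [Gb _] := sep_mem sepBA Bb.
have [x [z [Px Qz def_b]]] := factorG Gb.
have [v' Sv' v'z] := coverS z Qz; have Qv' := subsetP max_cycle_gens_sub v' Sv'.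
pose u' := if x == 1 then u else x.
have u'1: u' \in P^# by rewrite /u'; case: ifP => // /negbT x1; rewrite !inE x1.
have [_ Pu'] := setD1P u'1.
exists u' => //; exists v' => //.
apply: (owns_mem sepBA _ _ Bb); [exact: inG | exact: uncov |].
rewrite def_b cross_memE // v'z andbT /u'.
by case: eqP => [->|_]; rewrite ?group1 ?cycle_id.
Qed.

End CoprimeProduct.

(** * One cyclic and one non-cyclic factor *)

Section OneCyclicFactor.

Variables (gT : finGroupType) (G P Q : {group gT}) (p q : nat).
Hypotheses (abelG : abelian G) (defG : P * Q = G) (coPQ : coprime #|P| #|Q|).
Hypotheses (p_pr : prime p) (q_pr : prime q) (pP : p.-group P) (qQ : q.-group Q).
Hypotheses (ncP : ~~ cyclic P) (ntQ : Q :!=: 1).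

Lemma abelian_left_factor : abelian P. Proof. exact: abelianS (left_factor_sub defG) abelG. Qed.

Lemma exists_order_p v : v \in P ->
  exists t, [/\ t \in P, #[t] = p & t \notin <[v]>].
Proof.
move=> Pv; have [t Pt /andP[/eqP tp1 vt]] := noncyclic_new_elt p_pr pP abelian_left_factor ncP Pv.
exists t; split=> //; apply: nt_prime_order => //.
by apply: contraNneq vt => ->; apply: group1.
Qed.

(** Fix a subgroup <[u]> of order p of P and separate the elements x outside Q
    according to whether u is in <[x]>.  A cyclic group has at most one subgroup
    of order p, so neighbours are on the same side; and P, not being cyclic, has
    another subgroup of order p, so both sides are inhabited. *)
Lemma noncyclic_cutset : cutset G power_adj Q.
Proof.
have [u [Pu ou _]] := exists_order_p (group1 P).
have [t [Pt ot ut]] := exists_order_p Pu.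
have sPG := subsetP (left_factor_sub defG).
have nQ x : x \in P -> #[x] = p -> x \notin Q.
  move=> Px ox; apply/negP=> Qx; have := cross_coprime coPQ Px Qx.
  by rewrite /coprime gcdnn ox eqn_leq leqNgt prime_gt1.
apply: (@cutset_intro _ _ _ _ ((G :\: Q) :&: [set x | u \in <[x]>])
                              ((G :\: Q) :\: [set x | u \in <[x]>])).
- exact: right_factor_sub defG.
- by apply/set0Pn; exists u; rewrite !inE sPG ?nQ ?cycle_id.
- apply/set0Pn; exists t; rewrite !inE sPG ?nQ // andbT andbT.
  apply: contra ut => tu.
  suffices -> : <[u]> = <[t]> by apply: cycle_id.
  apply/eqP; rewrite (eq_subG_cyclic (cycle_cyclic t)) ?cycle_subG ?cycle_id //.
  by rewrite -!orderE ou ot.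
- by apply/pred0P=> x; rewrite /= !inE; case: (u \in _); rewrite ?andbF.
- by rewrite setID.
move=> a b; rewrite !inE => /andP[/andP[Qa Ga] ua] /and3P[ub Qb Gb].
rewrite /power_adj /= negb_and negb_or; apply/orP; right; apply/andP; split.
  by apply: contra ub => ab; apply: subsetP ua; rewrite cycle_subG.
apply: contra ub => ba.
have [x [y [Px Qy def_b]]] := factorG defG Gb.
have x1: x != 1.
  by apply: contraNneq Qb => x1; rewrite def_b x1 mul1g.
have [k ok] := pgroup_order_gt1 pP Px x1.
have: p %| #|<[b]>|.
  by rewrite -orderE def_b (cross_order abelG defG coPQ) // ok expnS -mulnA dvdn_mulr.
case/(Cauchy p_pr)=> c bc oc.
suffices -> : u \in <[b]> = (c \in <[b]>) by [].
have sba: <[b]> \subset <[a]> by rewrite cycle_subG.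
have eq_uc: <[u]> = <[c]>.
  apply/eqP; rewrite (eq_subG_cyclic (cycle_cyclic a)) ?cycle_subG //.
    by rewrite -!orderE ou oc.
  exact: (subsetP sba).
by rewrite -!cycle_subG eq_uc.
Qed.

Hypothesis cycQ : cyclic Q.

(** Every vertex lies in some <[u * r]> with u != 1, so both colours occur among
    these groups; they all contain Q, hence so does X. *)
Lemma uncovered_cyclic_factor (X : {set gT}) r :
    Q :=: <[r]> -> cutset G power_adj X ->
    {in P^#, forall u, ~~ covered X (u * r)} ->
  Q \subset X.
Proof.
move=> defQ cutX uncov; have Qr: r \in Q by rewrite defQ cycle_id.
have [A [B sepAB]] := cutset_separates cutX.
have [t [Pt ot]] := exists_order_p (group1 P); rewrite cycle1 inE => t1.
have cell A' B' a : separates G X A' B' -> a \in A' ->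
    exists2 u, u \in P^# & owns A' (u * r).
  move=> sep' Aa; have [Ga _] := sep_mem sep' Aa.
  have [x [y [Px Qy def_a]]] := factorG defG Ga.
  pose u := if x == 1 then t else x.
  have u1: u \in P^# by rewrite /u; case: eqP => [_|/eqP x1]; rewrite !inE ?t1 ?x1.
  have [_ Pu] := setD1P u1; exists u => //.
  apply: (owns_mem sep' _ (uncov u u1) Aa); first exact: (mem_cross defG).
  rewrite def_a (cross_memE abelG defG coPQ) // -defQ Qy andbT /u.
  by case: eqP => [->|_]; rewrite ?group1 ?cycle_id.
case: (sepAB) => /set0Pn[a Aa] /set0Pn[b Bb] _ _.
have [u /setD1P[_ Pu] Au] := cell _ _ _ sepAB Aa.
have [w /setD1P[_ Pw] Bw] := cell _ _ _ (separatesC sepAB) Bb.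
apply/subsetP=> z Qz.
by apply: (owns_cap sepAB Au Bw); rewrite (cross_mem_r abelG defG coPQ) // -defQ.
Qed.

Lemma leq_double_totient : #|Q| <= (totient #|Q|).*2.
Proof.
have [k ->] : exists k, #|Q| = (q ^ k.+1)%N.
  have /p_natP[[|k] ok] := qQ; last by exists k.
  by move: ntQ; rewrite -cardG_gt1 ok.
rewrite totient_pfactor //= expnS doubleMl leq_mul2r; apply/orP; right.
by move: (prime_gt1 q_pr); clear; lia.
Qed.

(** For p > 2 covering a single <[u * r]> takes at least 2 * totient #|Q|
    vertices, hence at least #|Q|, and the vertex 1 comes in addition. *)
Lemma cyclic_factor_sub_cutset (X : {set gT}) :
  2 < p -> cutset G power_adj X -> #|X| <= #|Q| -> Q \subset X.
Proof.
move=> p3 cutX leX; have [r defQ] := cyclicP cycQ.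
have Qr: r \in Q by rewrite defQ cycle_id.
have [A [B sepAB]] := cutset_separates cutX.
apply: (uncovered_cyclic_factor defQ cutX) => u /setD1P[u1 Pu].
have ur1: u * r != 1.
  apply: contraNneq u1 => ur1.
  have: u * r \in <[1 * 1]> by rewrite ur1 mulg1 group1.
  rewrite (cross_memE abelG defG coPQ) ?group1 //.
  by rewrite cycle1 inE => /andP[].
apply/negP=> /(covered_card1 ur1 (sep1 sepAB)).
rewrite (cross_totient abelG defG coPQ) // [#[r]]orderE -defQ.
rewrite ltnNge (leq_trans leX) //.
apply: leq_trans leq_double_totient _; rewrite -mul2n leq_mul2r.
by rewrite (leq_trans _ (totient_p_elt p_pr pP Pu u1)) ?ltn_predRL ?orbT.
Qed.

(** For p = 2 a covered <[u0 * r]> need not be too expensive, but by counting it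
    is the only one and u0 is an involution.  The vertices outside u0 *: Q lie
    in uncovered groups, so both sides cannot have one unless Q is in X.
    Suppose then that one side is inside u0 *: Q, and let b = u0 * y be of
    maximal order in it.  The part <[y]> of Q lies in <[b]> and in the groups
    owned by the other side, hence in X; for the other z in Q, the element
    u0 * z is a neighbour of b that is too large to be on its side, hence is
    in X.  Altogether this gives #|Q| elements of X. *)
Lemma cyclic_factor_le_cutset (X : {set gT}) :
  p = 2 -> cutset G power_adj X -> #|Q| <= #|X|.
Proof.
move=> p2 cutX; rewrite leqNgt; apply/negP=> ltX.
have [r defQ] := cyclicP cycQ; have Qr: r \in Q by rewrite defQ cycle_id.
have notQX : ~~ (Q \subset X).
  by apply: contraL ltX => /subset_leq_card; rewrite leqNgt.
have [|] := boolP [forall u in P^#, ~~ covered X (u * r)].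
  by move/forall_inP/(uncovered_cyclic_factor defQ cutX); apply/negP.
rewrite negb_forall_in => /existsP[u0 /andP[Pu01]]; rewrite negbK => Xu0.
have [u01 Pu0] := setD1P Pu01.
have totu u : u \in P -> totient #[u * r] = (totient #[u] * totient #|Q|)%N.
  by move=> Pu; rewrite (cross_totient abelG defG coPQ) // [#[r]]orderE -defQ.
(* An element of order 4 or more would give totient #[u0] >= 2. *)
have ou0 : #[u0] = 2.
  have [k ok] := pgroup_order_gt1 pP Pu0 u01.
  have := covered_card Xu0; rewrite totu // ok totient_pfactor // p2 /= mul1n.
  case: k {ok} => [|k] //; rewrite expnS => le_X.
  move: ltX; rewrite ltnNge (leq_trans leq_double_totient (leq_trans _ le_X)) //.
  by rewrite -mul2n -mulnA leq_mul2l leq_pmull // expn_gt0.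
have uncov u : u \in P^# -> u != u0 -> ~~ covered X (u * r).
  move=> /setD1P[u1 Pu] u_u0; apply/negP=> Xu.
  have := covered2_card Xu0 Xu; rewrite !totu //.
  have: <[u0 * r]> != <[u * r]>.
    apply: contraNneq u_u0 => /(cross_cycle_inj abelG defG coPQ Pu0 Qr Pu Qr)[eq_u _].
    by have := cycle_id u; rewrite -eq_u (cycle2g ou0) !inE (negPf u1).
  move=> neq /(_ neq); rewrite leqNgt => /negP[]; apply: leq_trans ltX _.
  apply: leq_trans leq_double_totient _; rewrite -addnn leq_add // leq_pmull //.
    by have := totient_p_elt p_pr pP Pu0 u01; rewrite p2.
  by have := totient_p_elt p_pr pP Pu u1; rewrite p2.
have [t [Pt ot u0t]] := exists_order_p Pu0.
have t1 : t != 1 by apply: contraNneq u0t => ->.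
have tu0 : t != u0 by apply: contraNneq u0t => ->; apply: cycle_id.
have Pt1 : t \in P^# by rewrite !inE t1.
(* A vertex a outside u0 *: Q lies in an uncovered group: t replaces a trivial
   coordinate in P. *)
pose col := u0 *: Q.
have cell A B a : separates G X A B -> a \in A -> a \notin col ->
    exists2 u, u \in P & owns A (u * r).
  move=> sepAB Aa colNa; have [Ga _] := sep_mem sepAB Aa.
  have [x [y [Px Qy def_a]]] := factorG defG Ga.
  pose u := if x == 1 then t else x.
  have u1: u \in P^#.
    by rewrite /u; case: eqP => [_|/eqP x1]; rewrite !inE ?t1 ?x1.
  have uu0: u != u0.
    rewrite /u; case: (x =P 1) => // _; apply: contraNneq colNa => x_u0.
    by rewrite def_a x_u0 mem_lcoset mulKg.
  have [_ Pu] := setD1P u1; exists u => //.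
  apply: (owns_mem sepAB _ (uncov u u1 uu0) Aa); first exact: (mem_cross defG).
  rewrite def_a (cross_memE abelG defG coPQ) // -defQ Qy andbT /u.
  by case: eqP => [->|_]; rewrite ?group1 ?cycle_id.
have no_side A B : separates G X A B -> B \subset col -> False.
  move=> sepAB sBcol; have sepBA := separatesC sepAB.
  case: (sepAB) => _ /set0Pn[b1 Bb1] _ _.
  case: (arg_maxnP (fun b => #[b]) Bb1) => b Bb max_b.
  have /lcosetP[y Qy def_b] := subsetP sBcol b Bb.
  have Aw : owns A (t * r).
    have Gtr : t * r \in G by apply: (mem_cross defG).
    case: (owns_or sepAB Gtr (uncov t Pt1 tu0)) => // -[b' Bb' eq_b'].
    have /lcosetP[y' Qy' def_b'] := subsetP sBcol b' Bb'.
    move: eq_b'; rewrite def_b'.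
    case/(cross_cycle_inj abelG defG coPQ Pu0 Qy' Pt Qr) => eq_u _.
    by rewrite eq_u cycle_id in u0t.
  pose f z := if z \in <[y]> then z else u0 * z.
  have f_inj : {in Q &, injective f}.
    move=> z z' Qz Qz'; rewrite /f; case: ifP => yz; case: ifP => yz' //.
    - rewrite -{1}[z]mul1g => /(cross_inj coPQ (group1 P) Qz Pu0 Qz')[u0_1].
      by rewrite -u0_1 eqxx in u01.
    - rewrite -{1}[z']mul1g => /(cross_inj coPQ Pu0 Qz (group1 P) Qz')[u0_1].
      by rewrite u0_1 eqxx in u01.
    exact: mulgI.
  suffices: f @: Q \subset X.
    by move/subset_leq_card; rewrite card_in_imset // leqNgt ltX.
  apply/subsetP=> _ /imsetP[z Qz ->]; rewrite /f; case: ifPn => yz.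
    have: owns B b by exists b.
    move/(owns_cap sepAB Aw); apply.
      by rewrite (cross_mem_r abelG defG coPQ) // -defQ.
    by rewrite def_b (cross_mem_r abelG defG coPQ).
  (* The subgroups of the cyclic q-group Q form a chain. *)
  have zy : y \in <[z]>.
    have [sy sz] : <[y]> \subset Q /\ <[z]> \subset Q by rewrite !cycle_subG.
    have /p_natP[i oy] := mem_p_elt qQ Qy; have /p_natP[j oz] := mem_p_elt qQ Qz.
    rewrite -cycle_subG -(cardSg_cyclic cycQ) // -!orderE oy oz.
    rewrite dvdn_exp2l // leqNgt; apply: contra yz => ji.
    rewrite -cycle_subG -(cardSg_cyclic cycQ) // -!orderE oy oz.
    by rewrite dvdn_exp2l // ltnW.
  apply: contraT => Xz; have [_ /negP[]] := sep_mem sepBA Bb.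
  case: sepAB => _ _ dU _; have: u0 * z \in A :|: B.
    by rewrite dU inE Xz (mem_cross defG).
  case/setUP=> [Az | /max_b].
    apply: (sep_cap (separatesC sepBA) Az Bb); last exact: cycle_id.
    by rewrite def_b (cross_memE abelG defG coPQ) // cycle_id.
  rewrite def_b /= !(cross_order abelG defG coPQ) // leq_mul2l ou0 /= => le_zy.
  have: <[y]> == <[z]> by rewrite eqEcard cycle_subG zy.
  by move/eqP=> eq_yz; rewrite eq_yz cycle_id in yz.
have [A [B sepAB]] := cutset_separates cutX.
have [/subsetPn[a Aa a0]|] := boolP (~~ (A \subset col)); last first.
  by rewrite negbK; apply: no_side (separatesC sepAB).
have [/subsetPn[b Bb b0]|] := boolP (~~ (B \subset col)); last first.
  by rewrite negbK; apply: no_side sepAB.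
have [u Pu Au] := cell _ _ _ sepAB Aa a0.
have [w Pw Bw] := cell _ _ _ (separatesC sepAB) Bb b0.
case/negP: notQX; apply/subsetP=> z Qz.
by apply: (owns_cap sepAB Au Bw); rewrite (cross_mem_r abelG defG coPQ) // -defQ.
Qed.

End OneCyclicFactor.

(** * Maximal cyclic subgroups *)

Section MaximalCyclic.

Variables (gT : finGroupType) (G : {group gT}).
Implicit Type C : {group gT}.

Lemma card_nongenerators C : cyclic C -> #|nongenerators C| = (#|C| - totient #|C|)%N.
Proof.
case/cyclicP=> g defC; rewrite {2 3}defC -orderE totient_gen orderE -defC.
have sgC : [set x | generator C x] \subset C.
  by apply/subsetP=> x; rewrite inE => /eqP->; apply: cycle_id.
rewrite -cardsDS //; apply: eq_card => x.
by rewrite !inE andbC.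
Qed.

(** By maximality a generator of C is adjacent only to elements of C. *)
Lemma max_cyclic_cutset C :
  ~~ cyclic G -> max_cyclic G C -> cutset G power_adj (nongenerators C).
Proof.
move=> ncG /maxgroupP[/andP[sCG cycC] maxC]; have [g defC] := cyclicP cycC.
have gC : generator C g by rewrite defC /generator.
have inC x : generator C x -> x \in C by move/eqP->; apply: cycle_id.
apply: (@cutset_intro _ _ _ _ [set x | generator C x] (G :\: C)).
- by apply: subset_trans sCG; apply/subsetP=> x; rewrite inE => /andP[].
- by apply/set0Pn; exists g; rewrite inE.
- rewrite setD_eq0; apply: contra ncG => sGC.
  by apply: cyclicS sGC cycC.
- apply/pred0P=> x; rewrite /= !inE; apply/negP=> /and3P[/inC Cx C'x _].
  by rewrite Cx in C'x.
- apply/setP=> x; rewrite !inE.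
  have := inC x; case: (boolP (generator C x)) => [_ /(_ isT) Cx|_ _].
    by rewrite Cx (subsetP sCG).
  by rewrite andbT.
move=> a b; rewrite !inE => /eqP gen_a /andP[C'b Gb].
rewrite /power_adj /= negb_and negb_or; apply/orP; right; apply/andP; split.
  apply: contra C'b => ab; have sC : C \subset <[b]> by rewrite gen_a cycle_subG.
  have <- : <[b]>%G = C :> {set gT}; last exact: cycle_id.
  by apply: maxC => //; rewrite cycle_cyclic cycle_subG Gb.
by rewrite -gen_a.
Qed.

Definition max_cycle_gens (Q : {set gT}) : {set gT} :=
  [set v in Q | [forall w in Q, (v \in <[w]>) ==> (w \in <[v]>)]].

Lemma max_cycle_gens_cover (Q : {set gT}) y :
  y \in Q -> exists2 v, v \in max_cycle_gens Q & y \in <[v]>.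
Proof.
move=> Qy; have Py : [pred v in Q | y \in <[v]>] y by rewrite /= Qy cycle_id.
case: (arg_maxnP (fun v => #[v]) Py) => v /andP[Qv vy] max_v.
exists v => //; rewrite inE Qv; apply/forall_inP=> w Qw; apply/implyP=> wv.
have /eqP -> : <[v]> == <[w]>; last exact: cycle_id.
rewrite eqEcard cycle_subG wv -!orderE.
by apply: max_v; rewrite /= Qw; apply: subsetP vy; rewrite cycle_subG.
Qed.

End MaximalCyclic.

(** * Two non-cyclic factors *)

Section TwoNoncyclicFactors.

Variables (gT : finGroupType) (G P Q : {group gT}) (p q : nat).
Hypotheses (abelG : abelian G) (defG : P * Q = G) (coPQ : coprime #|P| #|Q|).
Hypotheses (p_pr : prime p) (q_pr : prime q) (lt_pq : p < q).
Hypotheses (pP : p.-group P) (qQ : q.-group Q).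

Lemma leq_cyclic_union (X : {set gT}) u v :
    u \in P -> v \in Q -> <[u]> \subset X -> <[v]> \subset X ->
  #[u] + #[v] <= #|X|.+1.
Proof.
move=> Pu Qv sux svx; rewrite !orderE -cardsUI.
rewrite [_ :&: _](_ : _ = 1) ?cards1 ?addn1 ?ltnS.
  by apply: subset_leq_card; rewrite subUset sux.
by apply: coprime_TIg; rewrite -!orderE (cross_coprime coPQ).
Qed.

(** Below p + q - 1 vertices no cell can be covered, so the owned row and column
    give a cell (u', v') of the other colour with <[u']> and <[v']> in X.  These
    two subgroups meet in 1 and have at least p + q - 1 elements together. *)
Lemma cutset_lower_small (X : {set gT}) :
    2 < p -> Q :!=: 1 -> cutset G power_adj X ->
    ~~ (P \subset X) -> ~~ (Q \subset X) ->
  p + q <= #|X|.+1.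
Proof.
move=> p3 ntQ cutX PX QX; rewrite leqNgt; apply/negP=> ltX.
have coverS : {in Q, forall y, exists2 v, v \in Q^# & y \in <[v]>}.
  move=> y Qy; have [-> | y1] := eqVneq y 1; last by exists y; rewrite ?cycle_id // !inE y1.
  by have [v Qv v1] := trivgPn _ ntQ; exists v; rewrite ?group1 // !inE v1.
have uncov : {in P^# & Q^#, forall u v, ~~ covered X (u * v)}.
  move=> u v /setD1P[u1 Pu] /setD1P[v1 Qv]; apply/negP=> /covered_card leX.
  move: ltX; rewrite ltnNge (leq_trans (leq_predn_mul p3 lt_pq)) // ltnS.
  apply: leq_trans leX; rewrite (cross_totient abelG defG coPQ) //.
  exact: leq_mul (totient_p_elt p_pr pP Pu u1) (totient_p_elt q_pr qQ Qv v1).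
have [A [B [sepAB]]] := exists_owned_row_column abelG defG coPQ (subsetDl _ _) coverS
  uncov cutX PX QX.
case=> u /setD1P[_ Pu] [v /setD1P[_ Qv]] [rowA colA [u' Pu' [v' Qv' Buv]]].
have [u'1 Pu''] := setD1P Pu'; have [v'1 Qv''] := setD1P Qv'.
have: #[u'] + #[v'] <= #|X|.+1.
  apply: leq_cyclic_union => //; apply/subsetP=> z z_in.
    have Pz : z \in P by apply: subsetP z_in; rewrite cycle_subG.
    by apply: (owns_cap sepAB (colA u' Pu') Buv); rewrite (cross_mem_l abelG defG coPQ).
  have Qz : z \in Q by apply: subsetP z_in; rewrite cycle_subG.
  by apply: (owns_cap sepAB (rowA v' Qv') Buv); rewrite (cross_mem_r abelG defG coPQ).
rewrite leqNgt (leq_trans ltX) //.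
have [k ->] := pgroup_order_gt1 pP Pu'' u'1.
have [j ->] := pgroup_order_gt1 qQ Qv'' v'1.
by rewrite !expnS leq_add // leq_pmulr // expn_gt0 prime_gt0.
Qed.

Local Notation S := (max_cycle_gens Q).

Hypotheses (ncP : ~~ cyclic P) (ncQ : ~~ cyclic Q) (abelemP : p.-abelem P).

Lemma max_cycle_gens_sub : S \subset Q. Proof. by apply/subsetP=> v; rewrite inE => /andP[]. Qed.

Lemma max_cycle_gens_neq1 v : v \in S -> v != 1.
Proof.
rewrite inE => /andP[_ /forall_inP maxv]; apply: contraNneq ncQ => v1.
suffices -> : Q :=: 1 by apply: cyclic1.
apply/trivgP/subsetP=> w Qw; have := maxv w Qw.
by rewrite v1 group1 cycle1.
Qed.

Lemma order_abelem u : u \in P^# -> #[u] = p.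
Proof. by case/setD1P=> u1 Pu; rewrite (abelem_order_p abelemP). Qed.

(** In an elementary abelian P all non-trivial cyclic subgroups are maximal. *)
Lemma max_cyclic_cross u v :
  u \in P^# -> v \in S -> max_cyclic G <[u * v]>.
Proof.
move=> Pu1 Sv; have [u1 Pu] := setD1P Pu1; have Qv := subsetP max_cycle_gens_sub v Sv.
apply/maxgroupP; split=> [|H /andP[sHG /cyclicP[h defH]] suvH].
  by rewrite cycle_cyclic cycle_subG (mem_cross defG).
apply/eqP; rewrite eqEsubset suvH andbT.
have Gh: h \in G by rewrite (subsetP sHG) // defH cycle_id.
have [x [y [Px Qy def_h]]] := factorG defG Gh.
move: suvH; rewrite defH !cycle_subG def_h !(cross_memE abelG defG coPQ) //.
case/andP=> xu yv; move: Sv; rewrite inE => /andP[_ /forall_inP/(_ y Qy)].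
rewrite yv => /= ->; rewrite andbT.
have x1 : x \in P^#.
  by rewrite !inE Px andbT; apply: contraTneq xu => ->; rewrite cycle1 inE.
have eq_ux : <[u]> = <[x]>.
  by apply/eqP; rewrite eqEcard cycle_subG xu -!orderE !order_abelem /=.
by rewrite eq_ux cycle_id.
Qed.

(** If t ^+ q = 1 and t is not in <[v]>, then v * t has the same q-th power as v,
    and a maximal cyclic subgroup containing v * t cannot be <[v]>. *)
Lemma sibling_cycle v : v \in S ->
  exists w, [/\ w \in S, <[w]> != <[v]> & v ^+ q \in <[w]>].
Proof.
move=> Sv; have Qv := subsetP max_cycle_gens_sub v Sv; have abQ := abelianS (right_factor_sub defG) abelG.
have [t Qt /andP[/eqP tq vt]] := noncyclic_new_elt q_pr qQ abQ ncQ Qv.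
have [w Sw wvt] := max_cycle_gens_cover (groupM Qv Qt).
exists w; split=> //.
  apply: contra vt => /eqP eq_wv.
  by move: wvt; rewrite eq_wv groupMl ?cycle_id.
have <- : (v * t) ^+ q = v ^+ q; last exact: groupX.
by rewrite expgMn ?tq ?mulg1 //; apply: (centsP abQ).
Qed.

Lemma card_nongen_cross u v m : u \in P^# -> v \in Q ->
  #[v] = (q ^ m.+1)%N -> #|nongenerators <[u * v]>| = ((p + q).-1 * q ^ m)%N.
Proof.
move=> Pu1 Qv ov; have [u1 Pu] := setD1P Pu1.
rewrite card_nongenerators ?cycle_cyclic // -!orderE.
rewrite (cross_totient abelG defG coPQ) // (cross_order abelG defG coPQ) //.
rewrite order_abelem // totient_prime // ov totient_pfactor // expnS.
by rewrite nongenerators_arith ?prime_gt0.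
Qed.

(** A trivial coordinate in P, or a coordinate in Q that does not generate a
    maximal cyclic subgroup, could be replaced so as to enlarge C. *)
Lemma max_cyclic_crossP (C : {group gT}) : max_cyclic G C ->
  exists u v, [/\ u \in P^#, v \in S & C :=: <[u * v]>].
Proof.
case/maxgroupP=> /andP[sCG /cyclicP[z defC]] maxC.
have Gz : z \in G by rewrite (subsetP sCG) // defC cycle_id.
have [x [y [Px Qy def_z]]] := factorG defG Gz.
have [t Pt t1] : exists2 t, t \in P & t != 1.
  by apply/trivgPn; apply: contraNneq ncP => ->; apply: cyclic1.
pose u := if x == 1 then t else x.
have Pu1 : u \in P^#.
  by rewrite /u; case: (x =P 1) => [_|/eqP x1]; rewrite !inE ?t1 ?x1.
have [_ Pu] := setD1P Pu1.
have [v Sv vy] := max_cycle_gens_cover Qy; have Qv := subsetP max_cycle_gens_sub v Sv.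
exists u, v; split=> //; apply/esym/maxC.
  by rewrite cycle_cyclic cycle_subG (mem_cross defG).
rewrite defC cycle_subG def_z (cross_memE abelG defG coPQ) // vy andbT /u.
by case: (x =P 1) => [->|_]; rewrite ?group1 ?cycle_id.
Qed.

Variable k : nat.
Hypothesis order_ge : {in S, forall v, q ^ k.+1 <= #[v]}.

Lemma max_cycle_order v :
  v \in S -> exists m, [/\ k <= m, #[v] = (q ^ m.+1)%N & totient #[v] = (q.-1 * q ^ m)%N].
Proof.
move=> Sv; have [m om] := pgroup_order_gt1 qQ (subsetP max_cycle_gens_sub v Sv) (max_cycle_gens_neq1 Sv).
exists m; split=> //; last by rewrite om totient_pfactor.
by have := order_ge Sv; rewrite om leq_exp2l ?prime_gt1.
Qed.

Lemma max_cycle_order_ge v : v \in S ->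
  (q * q ^ k <= #[v]) && (q.-1 * q ^ k <= totient #[v]).
Proof.
case/max_cycle_order=> m [le_km -> ->]; rewrite -expnS leq_exp2l ?prime_gt1 // ltnS le_km.
by rewrite leq_mul2l leq_exp2l ?prime_gt1 // le_km orbT.
Qed.

Lemma leq_nongen_cross u v : u \in P^# -> v \in S ->
  (p + q).-1 * q ^ k <= #|nongenerators <[u * v]>|.
Proof.
move=> Pu1 Sv; have [m [le_km om _]] := max_cycle_order Sv.
rewrite (card_nongen_cross Pu1 (subsetP max_cycle_gens_sub v Sv) om).
by rewrite leq_mul2l leq_exp2l ?prime_gt1 // le_km orbT.
Qed.

(** Here the owned row and column give a cell (u', v') of the other colour B,
    with <[v']> in X.  If some non-generator z = x * y of <[u' * v']> is outside
    X, it is on the side B, <[x]> = <[u']> and y is a q-th power in <[v']>.  A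
    maximal cyclic <[w]> other than <[v']> that contains these q-th powers then
    has z in <[u' * w]>, so B owns this cell too, and comparison with the row
    owned by A puts <[w]> in X along with <[v']>. *)
Lemma uncovered_lower (X : {set gT}) :
    cutset G power_adj X -> ~~ (P \subset X) -> ~~ (Q \subset X) ->
    {in P^# & S, forall u v, ~~ covered X (u * v)} ->
  (p + q).-1 * q ^ k <= #|X|.
Proof.
move=> cutX PX QX uncov.
have [A [B [sepAB]]] := exists_owned_row_column abelG defG coPQ max_cycle_gens_sub
  (fun y => @max_cycle_gens_cover _ Q y) uncov cutX PX QX.
case=> u Pu1 [v Sv [rowA colA [u' Pu'1 [v' Sv' Buv]]]].
have [_ Pu] := setD1P Pu1; have Qv := subsetP max_cycle_gens_sub v Sv.
have [_ Pu'] := setD1P Pu'1; have Qv' := subsetP max_cycle_gens_sub v' Sv'.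
have sepBA := separatesC sepAB.
have column_in w u2 : w \in S -> u2 \in P -> owns B (u2 * w) -> <[w]> \subset X.
  move=> Sw Pu2 Bw; have Qw := subsetP max_cycle_gens_sub w Sw; apply/subsetP=> z wz.
  have Qz : z \in Q by apply: subsetP wz; rewrite cycle_subG.
  by apply: (owns_cap sepAB (rowA w Sw) Bw); rewrite (cross_mem_r abelG defG coPQ).
have svX := column_in _ _ Sv' Pu' Buv.
have [snX|/subsetPn[z]] := boolP (nongenerators <[u' * v']> \subset X).
  exact: leq_trans (leq_nongen_cross Pu'1 Sv') (subset_leq_card snX).
have G' : u' * v' \in G by apply: (mem_cross defG).
rewrite inE => /andP[z_in nz] X'z.
have Bz := owned_mem sepBA Buv G' z_in X'z.
have Gz : z \in G by apply: subsetP z_in; rewrite cycle_subG.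
have [x [y [Px Qy def_z]]] := factorG defG Gz.
move: z_in nz X'z Bz; rewrite {Gz}def_z (cross_memE abelG defG coPQ) //.
case/andP=> ux vy ngen X'z Bz.
have x1 : x != 1.
  apply: contraNneq X'z => ->; rewrite mul1g; exact: subsetP vy.
have Px1 : x \in P^# by rewrite !inE x1.
have eq_xu : <[x]> = <[u']>.
  by apply/eqP; rewrite eqEcard cycle_subG ux -!orderE !order_abelem /=.
have v'y : v' \notin <[y]>.
  apply: contra ngen => yv; rewrite /generator eqEsubset !cycle_subG.
  by rewrite !(cross_memE abelG defG coPQ) // yv vy ux eq_xu cycle_id.
have [w [Sw neq_wv wv]] := sibling_cycle Sv'.
have wy : y \in <[w]>.
  have := mem_cycle_prime_power q_pr qQ Qv' vy v'y; apply: subsetP.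
  by rewrite cycle_subG.
have swX : <[w]> \subset X.
  apply: (column_in w u' Sw Pu'); have Qw := subsetP max_cycle_gens_sub w Sw.
  apply: (owns_mem sepBA _ (uncov _ _ Pu'1 Sw) Bz).
    exact: (mem_cross defG).
  by rewrite (cross_memE abelG defG coPQ) // ux.
have := covered2_card (cycle_covered swX) (cycle_covered svX) neq_wv.
have /andP[_] := max_cycle_order_ge Sv'; have /andP[_] := max_cycle_order_ge Sw.
exact: two_gens_arith.
Qed.

(** Assume that X is smaller than both bounds.  Counting generators shows that
    (u0, v0) is the only covered cell and that X contains no maximal cyclic
    subgroup of Q, so that each column is monochromatic apart from the covered
    cell.  Each vertex outside X lies in an uncovered cell, as it does not
    generate <[u0 * v0]>.  So there is a column of each colour, and comparing
    them row by row puts all of P but u0 in X.  Since u0 * v0 is in X and not in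
    P, this makes #|P| elements. *)
Lemma covered_lower (X : {set gT}) u0 v0 :
    p = 2 -> cutset G power_adj X -> u0 \in P^# -> v0 \in S ->
    covered X (u0 * v0) ->
  minn #|P| ((p + q).-1 * q ^ k) <= #|X|.
Proof.
move=> p2 cutX Pu01 Sv0 X0; rewrite geq_min.
have [// | ltP /=] := leqP #|P| #|X|; rewrite leqNgt; apply/negP=> ltX.
have [u01 Pu0] := setD1P Pu01; have Qv0 := subsetP max_cycle_gens_sub v0 Sv0.
have tot u v : u \in P^# -> v \in S -> q.-1 * q ^ k <= totient #[u * v].
  move=> Pu1 Sv; have [_ Pu] := setD1P Pu1; have Qv := subsetP max_cycle_gens_sub v Sv.
  rewrite (cross_totient abelG defG coPQ) // order_abelem // p2 mul1n.
  by case/andP: (max_cycle_order_ge Sv).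
have uniq_cov u v : u \in P^# -> v \in S -> covered X (u * v) ->
    u = u0 /\ <[v]> = <[v0]>.
  move=> Pu1 Sv Xuv; have [u1 Pu] := setD1P Pu1; have Qv := subsetP max_cycle_gens_sub v Sv.
  have [eq_uv|neq] := eqVneq <[u * v]> <[u0 * v0]>.
    have [eq_u ->] := cross_cycle_inj abelG defG coPQ Pu Qv Pu0 Qv0 eq_uv.
    split=> //; have := cycle_id u.
    by rewrite eq_u (cycle2g (etrans (order_abelem Pu01) p2)) !inE (negPf u1) => /eqP.
  have := covered2_card Xuv X0 neq.
  move/(two_gens_arith lt_pq (tot _ _ Pu1 Sv) (tot _ _ Pu01 Sv0)).
  by rewrite leqNgt ltX.
have colX v : v \in S -> ~~ (<[v]> \subset X).
  move=> Sv; apply/negP=> svX; have Qv := subsetP max_cycle_gens_sub v Sv.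
  have: #|<[v]>| + totient #[u0 * v0] <= #|X|.
    rewrite totient_gen -cardsUI [_ :&: _](_ : _ = set0) ?cards0 ?addn0.
      by apply: subset_leq_card; rewrite subUset svX.
    apply/setP=> z; rewrite !inE; apply/negP=> /andP[vz /eqP gz].
    have Qz : z \in Q by apply: subsetP vz; rewrite cycle_subG.
    have: u0 \in <[1 * z]> by rewrite mul1g -gz (cross_mem_l abelG defG coPQ) ?cycle_id.
    by rewrite (cross_mem_l abelG defG coPQ) // cycle1 inE (negPf u01).
  have le_v : q.-1 * q ^ k <= #|<[v]>|.
    rewrite -orderE; have /andP[+ _] := max_cycle_order_ge Sv; apply: leq_trans.
    by rewrite leq_mul2r leq_pred orbT.
  move/(two_gens_arith lt_pq le_v (tot _ _ Pu01 Sv0)).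
  by rewrite leqNgt ltX.
(* t fills the place of a trivial coordinate in P. *)
have [t Pt /andP[_ u0t]] := noncyclic_new_elt p_pr pP (abelianS (left_factor_sub defG) abelG) ncP Pu0.
have t1 : t \in P^#.
  by rewrite !inE Pt andbT; apply: contraNneq u0t => ->.
have tu0 : t != u0 by apply: contraNneq u0t => ->; apply: cycle_id.
have column A B a : separates G X A B -> a \in A -> exists2 v, v \in S &
    {in P^#, forall u, ~~ covered X (u * v) -> owns A (u * v)}.
  move=> sepAB Aa; have [Ga X'a] := sep_mem sepAB Aa.
  have [u1 [v [Pu1 Sv uncov a_in]]] : exists u v,
      [/\ u \in P^#, v \in S, ~~ covered X (u * v) & a \in <[u * v]>].
    have [x [y [Px Qy def_a]]] := factorG defG Ga.
    have [v Sv vy] := max_cycle_gens_cover Qy; have Qv := subsetP max_cycle_gens_sub v Sv.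
    have [x1 | x1] := eqVneq x 1.
      exists t, v; split=> //.
        by apply/negP=> /(uniq_cov _ _ t1 Sv)[tu _]; rewrite tu eqxx in tu0.
      by rewrite def_a x1 (cross_memE abelG defG coPQ) // group1.
    have Px1 : x \in P^# by rewrite !inE x1.
    have [cov | uncov] := boolP (covered X (x * v)); last first.
      by exists x, v; split=> //; rewrite def_a (cross_memE abelG defG coPQ) // cycle_id.
    (* a is not a generator of the covered <[x * v]>, so y is a q-th power in
       <[v]> and lies in a sibling of <[v]>, whose cell is not covered. *)
    have v'y : v \notin <[y]>.
      apply: contra X'a => yv; apply: (subsetP cov); rewrite inE /generator.
      rewrite eqEsubset !cycle_subG def_a.
      by rewrite !(cross_memE abelG defG coPQ) // !cycle_id yv vy.
    have [w [Sw neq_wv wv]] := sibling_cycle Sv; have Qw := subsetP max_cycle_gens_sub w Sw.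
    exists x, w; split=> //.
      apply: contra neq_wv => /(uniq_cov _ _ Px1 Sw)[_ ->].
      by have [_ ->] := uniq_cov _ _ Px1 Sv cov.
    rewrite def_a (cross_memE abelG defG coPQ) // cycle_id.
    have := mem_cycle_prime_power q_pr qQ Qv vy v'y; apply: subsetP.
    by rewrite cycle_subG.
  have inG u : u \in P^# -> u * v \in G.
    by case/setD1P=> _ Pu; apply: (mem_cross defG) => //; apply: subsetP Sv; apply: max_cycle_gens_sub.
  have Auv := owns_mem sepAB (inG u1 Pu1) uncov Aa a_in.
  exists v => // u Pu uncov_u.
  case: (owns_or sepAB (inG u Pu) uncov_u) => // Bu.
  case/negP: (colX v Sv); apply/subsetP=> z vz; have Qv := subsetP max_cycle_gens_sub v Sv.
  have [_ Pu''] := setD1P Pu; have [_ Pu1'] := setD1P Pu1.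
  have Qz : z \in Q by apply: subsetP vz; rewrite cycle_subG.
  by apply: (owns_cap sepAB Auv Bu); rewrite (cross_mem_r abelG defG coPQ).
have [A [B sepAB]] := cutset_separates cutX.
case: (sepAB) => /set0Pn[a Aa] /set0Pn[b Bb] _ _.
have [v Sv colA] := column _ _ _ sepAB Aa.
have [w Sw colB] := column _ _ _ (separatesC sepAB) Bb.
have Qv := subsetP max_cycle_gens_sub v Sv; have Qw := subsetP max_cycle_gens_sub w Sw.
have sPX : P :\ u0 \subset X.
  apply/subsetP=> u /setD1P[uu0 Pu].
  have [-> | u1] := eqVneq u 1; first exact: sep1 sepAB.
  have Pu1 : u \in P^# by rewrite !inE u1.
  have uncov z : z \in S -> ~~ covered X (u * z).
    by move=> Sz; apply/negP=> /(uniq_cov _ _ Pu1 Sz)[eq_u _]; rewrite eq_u eqxx in uu0.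
  apply: (owns_cap sepAB (colA u Pu1 (uncov v Sv)) (colB u Pu1 (uncov w Sw)));
    by rewrite (cross_mem_l abelG defG coPQ) ?cycle_id.
have Xg : u0 * v0 \in X by apply: (subsetP X0); rewrite inE /generator eqxx.
have P'g : u0 * v0 \notin P :\ u0.
  rewrite inE groupMl // negb_and; apply/orP; right; apply/negP=> Pv0.
  have: v0 \in P :&: Q by rewrite inE Pv0.
  by rewrite coprime_TIg // inE (negPf (max_cycle_gens_neq1 Sv0)).
have: u0 * v0 |: (P :\ u0) \subset X by rewrite subUset sub1set Xg.
move/subset_leq_card; rewrite cardsU1 P'g; have := cardsD1 u0 P.
by rewrite Pu0 => <-; rewrite leqNgt ltP.
Qed.

(** For p > 2 a covered cell has at least (p - 1) * (q - 1) * q ^ k generators,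
    and this is at least (p + q - 1) * q ^ k because p < q. *)
Lemma cutset_lower_max (X : {set gT}) :
    cutset G power_adj X -> ~~ (P \subset X) -> ~~ (Q \subset X) ->
  minn #|P| ((p + q).-1 * q ^ k) <= #|X|.
Proof.
move=> cutX PX QX.
have [|] := boolP [forall u in P^#, [forall v in S, ~~ covered X (u * v)]].
  move=> /forall_inP uncov; rewrite geq_min uncovered_lower ?orbT // => u v Pu Sv.
  by have /forall_inP/(_ v Sv) := uncov u Pu.
rewrite negb_forall_in => /existsP[u /andP[Pu1]].
rewrite negb_forall_in => /existsP[v /andP[Sv]]; rewrite negbK => Xuv.
have [p3 | p_le2] := ltnP 2 p; last first.
  by apply: (covered_lower _ cutX Pu1 Sv Xuv); apply/eqP; rewrite eqn_leq p_le2 prime_gt1.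
rewrite geq_min; apply/orP; right; apply: leq_trans (covered_card Xuv).
have [_ Pu] := setD1P Pu1; have Qv := subsetP max_cycle_gens_sub v Sv.
rewrite (cross_totient abelG defG coPQ) // order_abelem // totient_prime //.
have /andP[_ le_v] := max_cycle_order_ge Sv.
apply: leq_trans (leq_mul (leqnn _) le_v); rewrite mulnA leq_mul2r.
apply/orP; right; move: (leq_predn_mul p3 lt_pq); clear; lia.
Qed.

End TwoNoncyclicFactors.

(** * Vertex connectivity of the power graph *)

Section Connectivities.

Variables (gT : finGroupType) (G P Q : {group gT}) (p q : nat).
Hypotheses (abelG : abelian G) (defG : P * Q = G) (coPQ : coprime #|P| #|Q|).
Hypotheses (p_pr : prime p) (q_pr : prime q).
Hypotheses (pP : p.-group P) (qQ : q.-group Q).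

Lemma min_cutset_cyclic_factor :
    ~~ cyclic P -> cyclic Q -> Q :!=: 1 ->
  min_cutset G power_adj Q /\ vertex_connectivity G power_adj = #|Q|.
Proof.
move=> ncP cycQ ntQ; have cutQ := noncyclic_cutset abelG defG coPQ p_pr pP ncP.
have minQ (X : {set gT}) : cutset G power_adj X -> #|Q| <= #|X|.
  move=> cutX; have [p3 | p_le2] := ltnP 2 p; last first.
    apply: (cyclic_factor_le_cutset abelG defG coPQ p_pr q_pr pP qQ ncP) => //.
    by apply/eqP; rewrite eqn_leq p_le2 prime_gt1.
  have [le_XQ | /ltnW //] := leqP #|X| #|Q|; apply: subset_leq_card.
  exact: (cyclic_factor_sub_cutset abelG defG coPQ p_pr q_pr pP qQ ncP).
split; last exact: vertex_connectivity_eq.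
by rewrite /min_cutset cutQ; apply/forall_inP.
Qed.

Lemma unique_min_cutset (X : {set gT}) :
    ~~ cyclic P -> cyclic Q -> Q :!=: 1 -> 2 < p ->
  min_cutset G power_adj X -> Q :=: X.
Proof.
move=> ncP cycQ ntQ p3 /andP[cutX /forall_inP minX].
have cutQ := noncyclic_cutset abelG defG coPQ p_pr pP ncP.
have le_XQ := minX _ cutQ; apply/eqP; rewrite eqEcard le_XQ andbT.
exact: (cyclic_factor_sub_cutset abelG defG coPQ p_pr q_pr pP qQ ncP).
Qed.

End Connectivities.

Lemma card_Sylow_two (gT : finGroupType) (G S : {group gT}) p q m n :
    prime p -> prime q -> p != q -> #|G| = (p ^ m * q ^ n)%N ->
  p.-Sylow(G) S -> #|S| = (p ^ m)%N.
Proof.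
move=> p_pr q_pr neq_pq oG sylS; rewrite (card_Hall sylS) p_part oG.
rewrite lognM ?expn_gt0 ?prime_gt0 // pfactorK // lognX logn_prime //.
by rewrite (negPf neq_pq) muln0 addn0.
Qed.

Lemma vertex_connectivity_min (T : finType) (V : {set T}) (e : rel T)
    (X Y Z : {set T}) (m := minn #|X| (minn #|Y| #|Z|)) :
    cutset V e X -> cutset V e Y -> cutset V e Z ->
    (forall W, cutset V e W -> m <= #|W|) ->
  vertex_connectivity V e = m.
Proof.
move=> cutX cutY cutZ min_m.
have [W cutW oW] : exists2 W, cutset V e W & #|W| = m.
  rewrite /m /minn; case: ifP => _; first by exists X.
  by case: ifP => _; [exists Y | exists Z].
by rewrite -oW; apply: vertex_connectivity_eq; rewrite ?oW.
Qed.

Theorem theorem1p3 (gT : finGroupType) (G P1 P2 : {group gT})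
    (p1 p2 n1 n2 : nat)
    (p1_prime : prime p1) (p2_prime : prime p2) (lt_p12 : p1 < p2)
    (n1_gt0 : 0 < n1) (n2_gt0 : 0 < n2)
    (abelG : abelian G) (ncycG : ~~ cyclic G)
    (oG : #|G| = (p1 ^ n1 * p2 ^ n2)%N)
    (sylP1 : p1.-Sylow(G) P1) (sylP2 : p2.-Sylow(G) P2) :
  [/\
      (~~ cyclic P1) (+) (~~ cyclic P2) ->
      [/\ ~~ cyclic P1 ->
            [/\ min_cutset G power_adj P2,
                vertex_connectivity G power_adj = #|P2|
              & #|P2| = (p2 ^ n2)%N],
          ~~ cyclic P2 ->
            [/\ min_cutset G power_adj P1,
                vertex_connectivity G power_adj = #|P1|
              & #|P1| = (p1 ^ n1)%N]
        & 3 <= p1 \/ p1 = 2 /\ ~~ cyclic P2 ->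
            exists! X : {set gT}, min_cutset G power_adj X],
      ~~ cyclic P1 -> ~~ cyclic P2 -> 3 <= p1 ->
      forall C : {group gT}, max_cyclic G C -> #|C| = (p1 * p2)%N ->
        vertex_connectivity G power_adj
          = minn #|P1| (minn #|P2| #|nongenerators C|)
    &
      ~~ cyclic P1 -> ~~ cyclic P2 -> p1.-abelem P1 ->
      forall C : {group gT}, min_order_max_cyclic G C ->
        vertex_connectivity G power_adj
          = minn #|P1| (minn #|P2| #|nongenerators C|)].
Proof.
have neq12 : p1 != p2 by rewrite neq_ltn lt_p12.
have oP1 := card_Sylow_two p1_prime p2_prime neq12 oG sylP1.
have oP2 : #|P2| = (p2 ^ n2)%N.
  by move: oG; rewrite mulnC => /card_Sylow_two-> //; rewrite eq_sym.
have coP : coprime #|P1| #|P2|.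
  by rewrite oP1 oP2 coprime_pexpl // coprime_pexpr // prime_coprime // dvdn_prime2.
have coP' : coprime #|P2| #|P1| by rewrite coprime_sym.
have [sP1G pP1 _] := and3P sylP1; have [sP2G pP2 _] := and3P sylP2.
have defG : P1 * P2 = G.
  by apply/eqP; rewrite eqEcard mul_subG //= coprime_cardMg // oG oP1 oP2.
have defG' : P2 * P1 = G.
  rewrite -defG; apply/normC/cents_norm; apply: sub_abelian_cent2 abelG _ _ => //.
have ntP1 : P1 :!=: 1 by rewrite -cardG_gt1 oP1 -{1}(expn0 p1) ltn_exp2l ?prime_gt1.
have ntP2 : P2 :!=: 1 by rewrite -cardG_gt1 oP2 -{1}(expn0 p2) ltn_exp2l ?prime_gt1.
have p2_gt2 : 2 < p2 by apply: leq_ltn_trans lt_p12; apply: prime_gt1.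
have cutP2 (nc1 : ~~ cyclic P1) := noncyclic_cutset abelG defG coP p1_prime pP1 nc1.
have cutP1 (nc2 : ~~ cyclic P2) := noncyclic_cutset abelG defG' coP' p2_prime pP2 nc2.
split.
- move=> xor12; split=> [nc1 | nc2 | hyp].
  + have [|? ?] := min_cutset_cyclic_factor abelG defG coP p1_prime p2_prime pP1 pP2 nc1 _ ntP2.
      by move: xor12; rewrite nc1 /= negbK.
    by [].
  + have [|? ?] := min_cutset_cyclic_factor abelG defG' coP' p2_prime p1_prime pP2 pP1 nc2 _ ntP1.
      by move: xor12; rewrite nc2 addbT negbK.
    by [].
  have [c2 | nc2] := boolP (cyclic P2).
    have nc1 : ~~ cyclic P1 by move: xor12; rewrite c2 addbF.
    have p1_gt2 : 2 < p1 by case: hyp => // -[_]; rewrite c2.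
    exists P2; split=> [|X].
      by case: (min_cutset_cyclic_factor abelG defG coP p1_prime p2_prime pP1 pP2 nc1 c2 ntP2).
    exact: (unique_min_cutset abelG defG coP p1_prime p2_prime pP1 pP2 nc1 c2 ntP2).
  have c1 : cyclic P1 by move: xor12; rewrite nc2 addbT negbK.
  exists P1; split=> [|X].
    by case: (min_cutset_cyclic_factor abelG defG' coP' p2_prime p1_prime pP2 pP1 nc2 c1 ntP1).
  exact: (unique_min_cutset abelG defG' coP' p2_prime p1_prime pP2 pP1 nc2 c1 ntP1).
- move=> nc1 nc2 p1_gt2 C maxC oC.
  have cutC := max_cyclic_cutset ncycG maxC.
  apply: vertex_connectivity_min => //; [exact: cutP1 | exact: cutP2 |] => X cutX.
  have cycC : cyclic C by case/maxgroupp/andP: maxC.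
  have onC : #|nongenerators C| = (p1 + p2).-1.
    rewrite card_nongenerators // oC totient_coprime ?prime_coprime ?dvdn_prime2 //.
    rewrite !totient_prime //; have := @nongenerators_arith p1 p2 1.
    by rewrite !muln1 => -> //; apply: prime_gt0.
  rewrite !geq_min; have [sX | nsX] := boolP (P1 \subset X).
    by rewrite (subset_leq_card sX).
  have [sX | nsX2] := boolP (P2 \subset X).
    by rewrite (subset_leq_card sX) ?orbT.
  have := cutset_lower_small abelG defG coP p1_prime p2_prime lt_p12
    pP1 pP2 p1_gt2 ntP2 cutX nsX nsX2.
  rewrite onC => le_X; apply/orP; right; apply/orP; right.
  by rewrite -ltnS prednK // addn_gt0 prime_gt0.
move=> nc1 nc2 ab1 C /andP[maxC /forall_inP minC].
have cutC := max_cyclic_cutset ncycG maxC.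
apply: vertex_connectivity_min => //; [exact: cutP1 | exact: cutP2 |] => X cutX.
have [u [v [Pu1 Sv defC]]] := max_cyclic_crossP abelG defG coP nc1 maxC.
have Qv := subsetP (max_cycle_gens_sub P2) v Sv.
have [k ov] := pgroup_order_gt1 pP2 Qv (max_cycle_gens_neq1 nc2 Sv).
have order_ge : {in max_cycle_gens P2, forall w, p2 ^ k.+1 <= #[w]}.
  move=> w Sw; have Qw := subsetP (max_cycle_gens_sub P2) w Sw; have [_ Pu] := setD1P Pu1.
  have := minC _ (max_cyclic_cross abelG defG coP ab1 Pu1 Sw).
  rewrite defC -!orderE !(cross_order abelG defG coP) // (order_abelem ab1) //.
  by rewrite leq_mul2l ov; case: (p1) p1_prime.
rewrite defC (card_nongen_cross abelG defG coP p1_prime p2_prime ab1 Pu1 Qv ov).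
rewrite minnCA geq_min.
have [sX | nsX2] := boolP (P2 \subset X); first by rewrite (subset_leq_card sX).
have [sX | nsX] := boolP (P1 \subset X).
  by rewrite geq_min (subset_leq_card sX) orbT.
by rewrite (@cutset_lower_max _ G P1 P2 p1 p2) ?orbT.
Qed.
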